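(* Let $\underline{\eta}(\theta) > 0$ hold, and let $\tilde{x}_\theta(\mathbf{u}) \in \mathcal{X}$ be an approximation to $x_\theta(\mathbf{u})$ such that $$\|x_\theta(\mathbf{u}) - \tilde{x}_\theta(\mathbf{u})\|_{\mathcal{X}} \le \varepsilon_\theta \|x_\theta(\mathbf{u})\|_{\mathcal{X}}, \qquad 0\le \varepsilon_\theta\le\varepsilon<1,$$ holds for all $\theta\in\mathcal{P}$ and $\mathbf{u}\in\mathbb{R}^M$. (1) Suppose $\mathbf{v} \in \arg\inf_{\mathbf{u}\in\mathbb{R}^M} \|\mathbf{u}\|_{\Sigma_{\mathrm{pr}}^{-1}}^{-1}\,\|L\tilde x_\theta(\mathbf{u})\|_{\Sigma_L^{-1}}$. Then $$\beta_G(\theta) \;\le\; \frac{\|Lx_\theta(\mathbf{v})\|_{\Sigma_L^{-1}}}{\|\mathbf{v}\|_{\Sigma_{\mathrm{pr}}^{-1}}} \;\le\; \beta_G(\theta) + 2\gamma_L\,\overline{\eta}(\theta)\,\varepsilon_\theta.$$ (2) Likewise, if $\mathbf{v} \in \arg\inf_{\mathbf{u}\in\mathbb{R}^M} \|\tilde x_\theta(\mathbf{u})\|_{\mathcal{X}}^{-1}\,\|L\tilde x_\theta(\mathbf{u})\|_{\Sigma_L^{-1}}$, then $$\beta_{L|\mathcal{W}}(\theta) \;\le\; \frac{\|Lx_\theta(\mathbf{v})\|_{\Sigma_L^{-1}}}{\|x_\theta(\mathbf{v})\|_{\mathcal{X}}} \;\le\; \frac{1+\varepsilon_\theta}{1-\varepsilon_\theta}\left(\beta_{L|\mathcal{W}}(\theta)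 + \gamma_L\,\varepsilon_\theta\right) + \gamma_L\,\varepsilon_\theta.$$
   Context: Setting. $\mathcal{X}$ is a real Hilbert space with inner product $\langle\cdot,\cdot\rangle_{\mathcal{X}}$, norm $\|\cdot\|_{\mathcal{X}}$ and dual $\mathcal{X}'$; $\mathcal{P} \subset \mathbb{R}^p$ is a compact set of hyper-parameters (configurations). For each $\theta\in\mathcal{P}$ and each parameter $\mathbf{u}\in\mathbb{R}^M$ there is a (full-order) state $x_\theta(\mathbf{u})\in\mathcal{X}$; the map $\mathbf{u}\mapsto x_\theta(\mathbf{u})$ is linear. $\Sigma_{\mathrm{pr}}\in\mathbb{R}^{M\times M}$ is a symmetric positive definite (prior covariance) matrix, and $\|\mathbf{u}\|_{\Sigma_{\mathrm{pr}}^{-1}}^2 := \mathbf{u}^T\Sigma_{\mathrm{pr}}^{-1}\mathbf{u}$. The states are uniformly bounded: there is $\bar\eta>0$ with $\overline{\eta}(\theta) := \sup_{\mathbf{u}\neq 0} \|x_\theta(\mathbf{u})\|_{\mathcal{X}} / \|\mathbf{u}\|_{\Sigma_{\mathrm{pr}}^{-1}} < \bar\eta$ for all $\theta\in\mathcal{P}$. The surrogate $\mathbf{u}\mapsto\tilde x_\theta(\mathbf{u})\in\mathcal{X}$ is not assumed to have further structure. Observation operator. $L = [\ell_1,\dots,\ell_K]^T : \mathcal{X}\to\mathbb{R}^K$, $Lx = [\ell_1(x),\dots,\ell_K(x)]^T$, with continuous linear functionals $\ell_k\in\mathcal{X}'$. $\Sigma_L\in\mathbb{R}^{K\times K}$ is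 symmetric positive definite (noise covariance), and $\|\mathbf{d}\|_{\Sigma_L^{-1}}^2 := \mathbf{d}^T\Sigma_L^{-1}\mathbf{d}$. Coefficients (all infima and suprema of quotients are over nonzero elements; ''$\mathbf{v}\in\arg\inf_{\mathbf{u}}$'' means that $\mathbf{v}\neq 0$ attains the infimum over nonzero $\mathbf{u}\in\mathbb{R}^M$): $$\gamma_L := \sup_{x\in\mathcal{X}} \frac{\|Lx\|_{\Sigma_L^{-1}}}{\|x\|_{\mathcal{X}}},\quad \underline{\eta}(\theta) := \inf_{\mathbf{u}\in\mathbb{R}^M}\frac{\|x_\theta(\mathbf{u})\|_{\mathcal{X}}}{\|\mathbf{u}\|_{\Sigma_{\mathrm{pr}}^{-1}}},\quad \mathcal{W}_\theta := \{x_\theta(\mathbf{u}) : \mathbf{u}\in\mathbb{R}^M\},$$ $$\beta_G(\theta) := \inf_{\mathbf{u}\in\mathbb{R}^M}\frac{\|Lx_\theta(\mathbf{u})\|_{\Sigma_L^{-1}}}{\|\mathbf{u}\|_{\Sigma_{\mathrm{pr}}^{-1}}},\qquad \beta_{L|\mathcal{W}}(\theta) := \inf_{x\in\mathcal{W}_\theta}\frac{\|Lx\|_{\Sigma_L^{-1}}}{\|x\|_{\mathcal{X}}}.$$ *)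

(* Defs.v *)
From HB Require Import structures.
From mathcomp Require Import all_boot all_order all_algebra.
From mathcomp Require Import all_classical all_reals all_analysis.

Set Implicit Arguments.
Unset Strict Implicit.
Unset Printing Implicit Defensive.

Import Order.TTheory GRing.Theory Num.Theory.
Import numFieldNormedType.Exports.

Local Open Scope classical_set_scope.
Local Open Scope ring_scope.

(* Together with completeness of X, this makes X a real Hilbert space:
   a form of type {dot X for idfun} is bilinear, symmetric and positive
   definite, and the norm of X is the one it induces. *)
Definition induces_norm (R : realType) (X : normedModType R)
    (dot : {dot X for idfun}) : Prop :=
  forall y : X, `|y| = Num.sqrt (dot y y).

Definition spd (R : realType) (n : nat) (S : 'M[R]_n) : Prop :=
  S \is symmetricmx /\
  forall u : 'cV[R]_n, u != 0 -> 0 < (u^T *m S *m u) 0 0.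

(* The norm weighted by the inverse of the covariance matrix S. *)
Definition invcov_norm (R : realType) (n : nat) (S : 'M[R]_n)
    (u : 'cV[R]_n) : R :=
  Num.sqrt ((u^T *m invmx S *m u) 0 0).

(* Infimum and supremum over the nonzero elements of A, in the extended
   reals, so that an unbounded quotient has supremum +oo. *)
Definition inf_nz (R : realType) (V : zmodType) (A : set V) (f : V -> R)
    : \bar R :=
  ereal_inf [set (f y)%:E | y in [set y | A y /\ y != 0]].

Definition sup_nz (R : realType) (V : zmodType) (A : set V) (f : V -> R)
    : \bar R :=
  ereal_sup [set (f y)%:E | y in [set y | A y /\ y != 0]].

Definition arginf_nz (R : realType) (V : zmodType) (f : V -> R) (v : V)
    : Prop :=
  v != 0 /\ (f v)%:E = inf_nz setT f.

Definition obs (R : realType) (X : normedModType R) (K : nat)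
    (ell : 'I_K -> {linear X -> R^o}) (y : X) : 'cV[R]_K :=
  \col_k ell k y.

(* In the definitions below, xt : 'cV[R]_M -> X is the state map
   u |-> x_theta(u) at a fixed configuration theta. *)

Definition gammaL (R : realType) (X : normedModType R) (K : nat)
    (ell : 'I_K -> {linear X -> R^o}) (SL : 'M[R]_K) : \bar R :=
  sup_nz setT (fun y : X => invcov_norm SL (obs ell y) / `|y|).

Definition eta_up (R : realType) (X : normedModType R) (M : nat)
    (Spr : 'M[R]_M) (xt : 'cV[R]_M -> X) : \bar R :=
  sup_nz setT (fun u => `|xt u| / invcov_norm Spr u).

Definition eta_low (R : realType) (X : normedModType R) (M : nat)
    (Spr : 'M[R]_M) (xt : 'cV[R]_M -> X) : \bar R :=
  inf_nz setT (fun u => `|xt u| / invcov_norm Spr u).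

Definition betaG (R : realType) (X : normedModType R) (M K : nat)
    (ell : 'I_K -> {linear X -> R^o}) (SL : 'M[R]_K) (Spr : 'M[R]_M)
    (xt : 'cV[R]_M -> X) : \bar R :=
  inf_nz setT (fun u => invcov_norm SL (obs ell (xt u)) / invcov_norm Spr u).

Definition betaLW (R : realType) (X : normedModType R) (M K : nat)
    (ell : 'I_K -> {linear X -> R^o}) (SL : 'M[R]_K)
    (xt : 'cV[R]_M -> X) : \bar R :=
  inf_nz (range xt) (fun y => invcov_norm SL (obs ell y) / `|y|).

(* Main.v *)
Require Import Defs.
From HB Require Import structures.
From mathcomp Require Import all_boot all_order all_algebra.
From mathcomp Require Import all_classical all_reals all_analysis.
From mathcomp Require Import ring lra.

Set Implicit Arguments.
Unset Strict Implicit.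
Unset Printing Implicit Defensive.

Import Order.TTheory GRing.Theory Num.Theory.
Import numFieldNormedType.Exports.

Local Open Scope classical_set_scope.
Local Open Scope ring_scope.

(** The surrogate ratio is a uniform perturbation of the true ratio, so a
    minimizer of the one nearly minimizes the other.

    Write N y for the weighted norm of the observation L y.  Since N is a
    seminorm bounded by gamma_L times the norm of the state space
    ([gammaL_fin]), the states x(u) and xs(u) satisfy
    |N (x u) - N (xs u)| <= gamma_L |x u - xs u| <= gamma_L eps |x u|
    ([obs_perturb]).

    For the first ratio, dividing by the prior norm of u and bounding
    |x u| by eta_up times it shows that N (x u) / |u| and N (xs u) / |u|
    differ by at most d := gamma_L eta_up eps, for every u.  If v minimizes
    the second one, then for every u
    N (x v) / |v| <= N (xs v) / |v| + d <= N (xs u) / |u| + d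
                  <= N (x u) / |u| + 2 d,
    and the infimum over u gives the claim.

    For the second ratio the denominators change as well, but
    (1 - eps) |x u| <= |xs u| <= (1 + eps) |x u|.  Thus, with q u the
    surrogate ratio N (xs u) / |xs u|,
    N (x v) / |x v| <= (1 + eps) q v + gamma_L eps, and
    (1 - eps) q u <= N (x u) / |x u| + gamma_L eps for every u.
    Chaining these through q v <= q u and taking the infimum over u gives
    the claim.

    Everything takes place in the reals once the extended-real coefficients
    are known to be finite.  The infima are finite because the ratios are
    nonnegative and v provides a competitor; gamma_L is finite because L is
    continuous ([obs_bounded]), and eta_up by hypothesis.  Since eta_low is
    positive, x u is nonzero for nonzero u, so that none of the ratios has a
    zero denominator. *)

(** * Finite infima and suprema of quotients *)

(** A nonnegative quotient over a nonempty set has an infimum between 0 and one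
    of its values, so its lower-bound properties can be used in the reals. *)
Lemma inf_nz_fin (R : realType) (V : zmodType) (A : set V) (f : V -> R) :
  (forall y, 0 <= f y) -> (exists2 y, A y & y != 0) ->
  exists b : R, [/\ inf_nz A f = b%:E,
    forall y, A y -> y != 0 -> b <= f y &
    forall m, (forall y, A y -> y != 0 -> m <= f y) -> m <= b].
Proof.
move=> f0 [y0 Ay0 y0n0]; rewrite /inf_nz; set S := image _ _.
have lbS m : (forall y, A y -> y != 0 -> m <= f y) -> (m%:E <= ereal_inf S)%E.
  move=> mf; apply: le_ereal_inf_tmp => _ [y [Ay yn0] <-].
  by rewrite lee_fin mf.
have Slb y : A y -> y != 0 -> (ereal_inf S <= (f y)%:E)%E.
  by move=> Ay yn0; apply: ereal_inf_lbound; exists y.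
have Sge0 : (0 <= ereal_inf S)%E by apply: lbS => *; exact: f0.
have Slty : (ereal_inf S < +oo)%E := le_lt_trans (Slb y0 Ay0 y0n0) (ltry _).
have Sfin : ereal_inf S \is a fin_num by rewrite ge0_fin_numE.
exists (fine (ereal_inf S)); rewrite fineK//; split=> // [y Ay yn0|m mf].
  by rewrite -lee_fin fineK// Slb.
by rewrite -lee_fin fineK// lbS.
Qed.

Lemma sup_nz_fin (R : realType) (V : zmodType) (A : set V) (f : V -> R) :
  (exists2 y, A y & y != 0) -> (sup_nz A f < +oo)%E ->
  exists2 g : R, sup_nz A f = g%:E & forall y, A y -> y != 0 -> f y <= g.
Proof.
move=> [y0 Ay0 y0n0] Slty.
have Sub y : A y -> y != 0 -> ((f y)%:E <= sup_nz A f)%E.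
  by move=> Ay yn0; apply: ereal_sup_ubound; exists y.
have Sfin : sup_nz A f \is a fin_num.
  by rewrite fin_numElt Slty (lt_le_trans (ltNyr _) (Sub y0 Ay0 y0n0)).
exists (fine (sup_nz A f)); first by rewrite fineK.
move=> y Ay yn0; by rewrite -lee_fin fineK// Sub.
Qed.

(** * The norm weighted by an inverse covariance *)

Section SymmetricPositiveDefinite.
Variables (R : realType) (n : nat) (S : 'M[R]_n).
Hypothesis hS : spd S.

(** A vector u with u^T S = 0 has u^T S u = 0, hence vanishes. *)
Lemma spd_unitmx : S \in unitmx.
Proof.
rewrite -row_free_unit -kermx_eq0; apply/rowV0P => u /sub_kermxP uS0.
apply/eqP; rewrite -[u]trmxK trmx_eq0; apply: contraT => un0.
by have := hS.2 _ un0; rewrite trmxK uS0 mul0mx mxE ltxx.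
Qed.

Lemma spd_trmx : S^T = S.
Proof.
have := hS.1; rewrite is_hermitianmxE expr0 scale1r => /eqP {2}->.
by rewrite map_mx_id.
Qed.

(** The quadratic form of the inverse at u is that of S at S^-1 u. *)
Lemma spd_invmx : spd (invmx S).
Proof.
have trV : (invmx S)^T = invmx S by rewrite trmx_inv spd_trmx.
split=> [|u un0].
  by rewrite is_hermitianmxE expr0 scale1r map_mx_id// trV.
have Vun0 : invmx S *m u != 0.
  apply: contra un0 => /eqP Vu0.
  by rewrite -[u]mul1mx -(mulmxV spd_unitmx) -mulmxA Vu0 mulmx0.
have := hS.2 _ Vun0.
by rewrite trmx_mul trV -!mulmxA mulKVmx ?spd_unitmx// mulmxA.
Qed.
End SymmetricPositiveDefinite.

Section InvcovNorm.
Variables (R : realType) (n : nat) (S : 'M[R]_n).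
Hypothesis hS : spd S.
Let phi (u v : 'cV[R]_n) := (u^T *m invmx S *m v) 0 0.

Let phiDl u v w : phi (u + v) w = phi u w + phi v w.
Proof. by rewrite /phi linearD/= !mulmxDl mxE. Qed.
Let phiDr u v w : phi w (u + v) = phi w u + phi w v.
Proof. by rewrite /phi mulmxDr mxE. Qed.
Let phiZl a u w : phi (a *: u) w = a * phi u w.
Proof. by rewrite /phi linearZ/= -!scalemxAl mxE. Qed.
Let phiZr a u w : phi w (a *: u) = a * phi w u.
Proof. by rewrite /phi -scalemxAr mxE. Qed.
Let phiC u v : phi u v = phi v u.
Proof.
rewrite /phi -[in LHS](mxE trmx_key (fun i j => (u^T *m invmx S *m v) j i)).
by rewrite -/(trmx _) !trmx_mul trmxK (spd_trmx (spd_invmx hS)) mulmxA.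
Qed.

Lemma invcov_norm_gt0 u : u != 0 -> 0 < invcov_norm S u.
Proof. by move=> un0; rewrite sqrtr_gt0 (spd_invmx hS).2. Qed.

Lemma invcov_normZ a u : invcov_norm S (a *: u) = `|a| * invcov_norm S u.
Proof.
rewrite /invcov_norm -/(phi _ _) -/(phi u u) phiZl phiZr mulrA -expr2.
by rewrite sqrtrM ?sqr_ge0// sqrtr_sqr.
Qed.

(** Minkowski's inequality, from the Cauchy-Schwarz inequality for the form of
    the inverse matrix. *)
Lemma invcov_normD u v :
  invcov_norm S (u + v) <= invcov_norm S u + invcov_norm S v.
Proof.
have [->|un0] := eqVneq u 0.
  by rewrite add0r lerDr sqrtr_ge0.
have [->|vn0] := eqVneq v 0.
  by rewrite addr0 lerDl sqrtr_ge0.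
have a0 := invcov_norm_gt0 un0; have b0 := invcov_norm_gt0 vn0.
have phi_ge0 w : 0 <= phi w w.
  have [->|wn0] := eqVneq w 0; first by rewrite /phi mulmx0 mxE.
  exact: ltW ((spd_invmx hS).2 _ wn0).
have aE : phi u u = invcov_norm S u ^+ 2.
  by rewrite /invcov_norm -/(phi u u) sqr_sqrtr.
have bE : phi v v = invcov_norm S v ^+ 2.
  by rewrite /invcov_norm -/(phi v v) sqr_sqrtr.
move: a0 b0 aE bE; set a := invcov_norm S u; set b := invcov_norm S v.
move=> a0 b0 aE bE.
(* Cauchy-Schwarz: the form is nonnegative at |v| u - |u| v, where it equals
   2 |u| |v| (|u| |v| - phi u v). *)
have CS : phi u v <= a * b.
  have := phi_ge0 (b *: u + (- a) *: v).
  rewrite !(phiDl, phiDr, phiZl, phiZr) (phiC v u) aE bE.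
  rewrite (_ : _ + _ = 2 * (a * b) * (a * b - phi u v)); last by ring.
  by rewrite pmulr_rge0 ?subr_ge0// !mulr_gt0.
rewrite -(@ler_pXn2r _ 2)// ?nnegrE ?sqrtr_ge0 ?addr_ge0 ?sqrtr_ge0//.
rewrite sqr_sqrtr; last exact: phi_ge0.
rewrite -/(phi _ _) !(phiDl, phiDr) (phiC v u) aE bE.
lra.
Qed.
End InvcovNorm.

(** * The observation seminorm *)

Section Observation.
Variables (R : realType) (X : normedModType R) (K : nat).
Variables (ell : 'I_K -> {linear X -> R^o}) (SL : 'M[R]_K).
Hypotheses (hell : forall k, continuous (ell k)) (hSL : spd SL).

Lemma obsD y z : obs ell (y + z) = obs ell y + obs ell z.
Proof. by apply/colP => k; rewrite !mxE linearD. Qed.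

Lemma invcov_norm_sum (I : finType) (w : I -> 'cV[R]_K) :
  invcov_norm SL (\sum_i w i) <= \sum_i invcov_norm SL (w i).
Proof.
apply: (big_ind2 (fun a b => invcov_norm SL a <= b)) => // [|a1 b1 a2 b2 h1 h2].
  by rewrite /invcov_norm mulmx0 mxE sqrtr0.
exact: le_trans (invcov_normD hSL _ _) (lerD h1 h2).
Qed.

(** Each functional is bounded by continuity, and an observation is the
    combination of the unit vectors weighted by their values. *)
Lemma obs_bounded :
  exists C : R, forall y, invcov_norm SL (obs ell y) <= C * `|y|.
Proof.
have /choice[C hC] k : exists C : R, forall y, `|ell k y| <= C * `|y|.
  have /linear_boundedP := (linear_bounded_continuous (ell k)).2 (@hell k).
  by move=> /pinfty_ex_gt0[C _ hC]; exists C.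
exists (\sum_k C k * invcov_norm SL (delta_mx k 0)) => y.
have -> : obs ell y = \sum_k ell k y *: delta_mx k 0.
  by rewrite [LHS]matrix_sum_delta; apply: eq_bigr => k _; rewrite big_ord1 mxE.
apply: le_trans (invcov_norm_sum _) _; rewrite mulr_suml; apply: ler_sum => k _.
by rewrite invcov_normZ// mulrAC ler_wpM2r ?sqrtr_ge0.
Qed.

(** The vector z excludes the trivial space, in which gamma_L, a supremum over
    the empty set, would be -oo. *)
Lemma gammaL_fin (z : X) : z != 0 ->
  exists g : R, [/\ gammaL ell SL = g%:E, 0 <= g &
    forall y, invcov_norm SL (obs ell y) <= g * `|y|].
Proof.
move=> zn0; have [C hC] := obs_bounded.
have gC : (gammaL ell SL <= C%:E)%E.
  apply: ge_ereal_sup => _ [y [_ yn0] <-].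
  by rewrite lee_fin ler_pdivrMr ?normr_gt0.
have [g gE hg] :=
  sup_nz_fin (ex_intro2 _ _ z Logic.I zn0) (le_lt_trans gC (ltry _)).
exists g; split=> // [|y].
  by apply: le_trans (hg z Logic.I zn0); rewrite divr_ge0// sqrtr_ge0.
have [->|yn0] := eqVneq y 0.
  have := hC 0; rewrite !normr0 !mulr0; exact.
by rewrite -ler_pdivrMr ?normr_gt0 ?hg.
Qed.

Lemma obs_perturb (g : R) (y z : X) :
  (forall y, invcov_norm SL (obs ell y) <= g * `|y|) ->
  invcov_norm SL (obs ell y) <= invcov_norm SL (obs ell z) + g * `|y - z|.
Proof.
move=> hg; rewrite -{1}(subrK z y) addrC obsD.
by apply: le_trans (invcov_normD hSL _ _) _; rewrite lerD2l.
Qed.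
End Observation.

(** * Minimizers of the surrogate ratios *)

Theorem proposition3 (R : realType)
    (X : completeNormedModType R) (dot : {dot X for idfun})
    (hX : induces_norm dot)
    (p M K : nat)
    (P : set 'rV[R]_p) (hP : compact P)
    (x : 'rV[R]_p -> 'cV[R]_M -> X)
    (hx : forall theta, P theta -> linear (x theta))
    (Spr : 'M[R]_M) (hSpr : spd Spr)
    (eta_bar : R) (heta_bar : 0 < eta_bar)
    (hbound : forall theta, P theta -> (eta_up Spr (x theta) < eta_bar%:E)%E)
    (ell : 'I_K -> {linear X -> R^o})
    (hell : forall k, continuous (ell k))
    (SL : 'M[R]_K) (hSL : spd SL)
    (xs : 'rV[R]_p -> 'cV[R]_M -> X)
    (eps : 'rV[R]_p -> R) (eps_bar : R)
    (heps : forall theta, P theta -> 0 <= eps theta <= eps_bar)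
    (heps_bar : eps_bar < 1)
    (happrox : forall theta u, P theta ->
       `|x theta u - xs theta u| <= eps theta * `|x theta u|)
    (theta : 'rV[R]_p) (htheta : P theta)
    (heta : (0 < eta_low Spr (x theta))%E) :
  (forall v : 'cV[R]_M,
     arginf_nz (fun u => (invcov_norm Spr u)^-1 *
                         invcov_norm SL (obs ell (xs theta u))) v ->
     (betaG ell SL Spr (x theta) <=
        (invcov_norm SL (obs ell (x theta v)) / invcov_norm Spr v)%:E)%E /\
     ((invcov_norm SL (obs ell (x theta v)) / invcov_norm Spr v)%:E <=
        betaG ell SL Spr (x theta) +
        2%:E * gammaL ell SL * eta_up Spr (x theta) * (eps theta)%:E)%E) /\
  (forall v : 'cV[R]_M,
     arginf_nz (fun u => `|xs theta u|^-1 *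
                         invcov_norm SL (obs ell (xs theta u))) v ->
     (betaLW ell SL (x theta) <=
        (invcov_norm SL (obs ell (x theta v)) / `|x theta v|)%:E)%E /\
     ((invcov_norm SL (obs ell (x theta v)) / `|x theta v|)%:E <=
        ((1 + eps theta) / (1 - eps theta))%:E *
        (betaLW ell SL (x theta) + gammaL ell SL * (eps theta)%:E) +
        gammaL ell SL * (eps theta)%:E)%E).
Proof.
have e_ge0 : 0 <= eps theta by have /andP[] := heps _ htheta.
have e_lt1 : eps theta < 1.
  by have /andP[_ h] := heps _ htheta; exact: le_lt_trans h heps_bar.
have xlin := hx _ htheta.
have x_neq0 u : u != 0 -> x theta u != 0.
  move=> un0; apply/eqP => xu0.
  have : (eta_low Spr (x theta) <= 0%:E)%E.
    by apply: ereal_inf_lbound; exists u => //; rewrite xu0 normr0 mul0r.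
  by rewrite leNgt heta.
have close u := happrox _ u htheta.
move: (eps theta) e_ge0 e_lt1 close => e e_ge0 e_lt1 close.
pose N (y : X) := invcov_norm SL (obs ell y).
pose n u := invcov_norm Spr u.
have n_gt0 u : u != 0 -> 0 < n u by exact: invcov_norm_gt0.
have N_ge0 y : 0 <= N y by exact: sqrtr_ge0.
split=> v [vn0 vmin];
  have [g [gE g_ge0 hg]] := gammaL_fin hell hSL (x_neq0 v vn0).
- have [h hE hh] := sup_nz_fin (ex_intro2 _ _ v Logic.I vn0)
    (lt_trans (hbound _ htheta) (ltry _)).
  have [b [bE hb bmax]] := @inf_nz_fin R _ setT (fun u => N (x theta u) / n u)
    (fun u => divr_ge0 (N_ge0 _) (sqrtr_ge0 _)) (ex_intro2 _ _ v Logic.I vn0).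
  have -> : betaG ell SL Spr (x theta) = b%:E by [].
  rewrite gE [eta_up _ _]hE -!EFinM -EFinD !lee_fin; split; first exact: hb.
  have shift u : u != 0 -> g * `|x theta u - xs theta u| / n u <= g * h * e.
    move=> un0; rewrite -!mulrA ler_wpM2l// ler_pdivrMr ?n_gt0//.
    apply: le_trans (close u) _; rewrite mulrAC mulrC ler_wpM2r//.
    by rewrite -ler_pdivrMr ?n_gt0// hh.
  have fwd u : u != 0 ->
      N (x theta u) / n u <= (n u)^-1 * N (xs theta u) + g * h * e.
    move=> un0; apply: le_trans (lerD (lexx _) (shift u un0)).
    rewrite (mulrC (n u)^-1) -mulrDl ler_pM2r ?invr_gt0 ?n_gt0//.
    exact: obs_perturb.
  have bwd u : u != 0 ->
      (n u)^-1 * N (xs theta u) <= N (x theta u) / n u + g * h * e.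
    move=> un0; apply: le_trans (lerD (lexx _) (shift u un0)).
    rewrite (mulrC (n u)^-1) -mulrDl ler_pM2r ?invr_gt0 ?n_gt0// distrC.
    exact: obs_perturb.
  rewrite -lerBlDr; apply: bmax => u _ un0.
  have : (n v)^-1 * N (xs theta v) <= (n u)^-1 * N (xs theta u).
    by rewrite -lee_fin vmin; apply: ereal_inf_lbound; exists u.
  have := fwd v vn0; have := bwd u un0; rewrite /N /n; lra.
- have [b [bE hb bmax]] :=
    @inf_nz_fin R _ (range (x theta)) (fun y => N y / `|y|)
    (fun y => divr_ge0 (N_ge0 _) (normr_ge0 _))
    (ex_intro2 _ _ (x theta v) (ex_intro2 _ _ v Logic.I erefl) (x_neq0 v vn0)).
  have -> : betaLW ell SL (x theta) = b%:E by [].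
  rewrite gE !(=^~ EFinM, =^~ EFinD) !lee_fin.
  split; first by apply: hb; [exists v|exact: x_neq0].
  have x_gt0 u : u != 0 -> 0 < `|x theta u| by move/x_neq0; rewrite normr_gt0.
  have xs_le u : `|xs theta u| <= (1 + e) * `|x theta u|.
    have := ler_distD (x theta u) 0 (xs theta u).
    by have := close u; rewrite !sub0r !normrN; lra.
  have xs_ge u : (1 - e) * `|x theta u| <= `|xs theta u|.
    have := ler_distD (xs theta u) 0 (x theta u).
    by have := close u; rewrite !sub0r !normrN (distrC (xs _ _)); lra.
  have e1_gt0 : 0 < 1 - e by rewrite subr_gt0.
  have xs_gt0 u : u != 0 -> 0 < `|xs theta u|.
    by move=> un0; apply: lt_le_trans (xs_ge u); rewrite mulr_gt0// x_gt0.
  pose q u := `|xs theta u|^-1 * N (xs theta u).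
  have q_ge0 u : 0 <= q u by rewrite mulr_ge0// invr_ge0.
  have qE u : u != 0 -> N (xs theta u) = q u * `|xs theta u|.
    by move=> un0; rewrite /q mulrAC mulVf ?mul1r// gt_eqF// xs_gt0.
  have shift u : g * `|x theta u - xs theta u| <= g * e * `|x theta u|.
    by rewrite -mulrA ler_wpM2l.
  have fwd : N (x theta v) / `|x theta v| <= (1 + e) * q v + g * e.
    rewrite ler_pdivrMr ?x_gt0//.
    apply: le_trans (obs_perturb hSL (x theta v) (xs theta v) hg) _.
    rewrite mulrDl lerD// -/(N _) qE//.
    by rewrite (mulrC (1 + e)) -(mulrA (q v)) ler_wpM2l.
  have bwd u : u != 0 -> (1 - e) * q u <= N (x theta u) / `|x theta u| + g * e.
    move=> un0; rewrite -(ler_pM2r (x_gt0 u un0)) [leRHS]mulrDl.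
    rewrite divfK ?normr_eq0 ?x_neq0//.
    apply: (@le_trans _ _ (N (xs theta u))).
      by rewrite qE// (mulrC (1 - e)) -(mulrA (q u)) ler_wpM2l.
    apply: le_trans (obs_perturb hSL (xs theta u) (x theta u) hg) _.
    by rewrite lerD2l distrC.
  have qb : (1 - e) * q v <= b + g * e.
    rewrite -lerBlDr; apply: bmax => _ [u _ <-] xun0.
    (* By linearity x maps 0 to 0, so a nonzero state comes from a nonzero
       parameter, against which v is compared. *)
    have un0 : u != 0.
      apply: contra xun0 => /eqP ->.
      by have := xlin (-1) 0 0; rewrite !scaleN1r oppr0 addr0 addNr => ->.
    have qvu : q v <= q u.
      by rewrite -lee_fin vmin; apply: ereal_inf_lbound; exists u.
    rewrite lerBlDr; apply: le_trans (bwd u un0).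
    by rewrite ler_pM2l.
  apply: le_trans fwd _; rewrite lerD2r -mulrA ler_pM2l; last by lra.
  by rewrite mulrC ler_pdivlMr// mulrC.
Qed.
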